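(* Let $A\in\mathbb{R}^{n\times n}$, $b,x_0\in\mathbb{R}^n$, $r_0=b-Ax_0$, and $w_0\in\{r_0,\,Ar_0\}$. Let $V_{j+1}\in\mathbb{R}^{n\times(j+1)}$ and $\underline{H}_j\in\mathbb{R}^{(j+1)\times j}$ be the matrices generated by $j$ iterations of the Arnoldi process for $\mathcal{K}_j(A,w_0)$, so that $AV_j=V_{j+1}\underline{H}_j$. Let $U\in\mathbb{R}^{n\times k}$ be such that $C=AU$ has orthonormal columns, and put $\Phi=CC^T$ and $D_j=V_{j+1}^TC$. Let $y_j\in\mathbb{R}^j$ be the coefficient vector, with respect to $V_j$, arising from minimization of the residual over $\mathrm{range}(U)+\mathcal{K}_j(A,w_0)$, that is, $y_j$ satisfies $$\left(\underline{H}_j^T\underline{H}_j-\underline{H}_j^TD_jD_j^T\underline{H}_j\right)y_j=\underline{H}_j^T\left(V_{j+1}^T(I-\Phi)r_0\right).$$ Let $\underline{H}_j=Q_j\underline{R}_j$ be the QR-factorization obtained progressively using Givens rotations. Then the coefficient vector $y_j$ can be represented as the solution of the linear system $$\left(I-M_jM_j^T\right)R_jy_j=\left\{Q_j^T\left(V_{j+1}^T(I-\Phi)r_0\right)\right\}_{1:j},$$ where $M_j=\{Q_j^TD_j\}_{1:j}\in\mathbb{R}^{j\times k}$. Furthermore, the residual norm satisfies $$\left\|(I-CC^T)\left(b-A(x_0+V_jy_j)\right)\right\|^2\le\left|e_{j+1}^TQ_j^TV_{j+1}^Tr_0\right|^2+\left\|\left(I-V_{j+1}V_{j+1}^T\right)r_0\right\|^2,$$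 a bound which can be updated progressively (as the iteration number $j$ increases).
   Context: The norm is the Euclidean norm. The Krylov subspace is $\mathcal{K}_j(A,w_0)=\mathrm{span}\{w_0,Aw_0,\dots,A^{j-1}w_0\}$. The Arnoldi process starts from $v_1=w_0/\|w_0\|$ and at iteration $j$ has generated $V_{j+1}=[v_1,\dots,v_{j+1}]$ with orthonormal columns, where the columns of $V_j=[v_1,\dots,v_j]$ form an orthonormal basis of $\mathcal{K}_j(A,w_0)$, and an upper Hessenberg matrix $\underline{H}_j$ of orthogonalization coefficients, satisfying the Arnoldi relation $AV_j=V_{j+1}\underline{H}_j$. In the QR-factorization, $Q_j\in\mathbb{R}^{(j+1)\times(j+1)}$ is orthogonal, $\underline{R}_j\in\mathbb{R}^{(j+1)\times j}$ is upper triangular, and $R_j\in\mathbb{R}^{j\times j}$ consists of the first $j$ rows of $\underline{R}_j$. The notation $\{\cdot\}_{1:j}$ denotes the first $j$ rows of the argument, $I$ is the identity matrix of the appropriate size, and $e_{j+1}\in\mathbb{R}^{j+1}$ is the last canonical basis vector. The matrix $\Phi=CC^T$ is the orthogonal projector onto the column space of $C=AU$. The underlying method is augmented unprojected (range-restricted, if $w_0=Ar_0$) GMRES for $Ax=b$: the approximation $x_j=x_0+Uz_j+V_jy_j$ is chosen so that $\|b-Ax_j\|$ is minimal over corrections in $\mathrm{range}(U)+\mathcal{K}_j(A,w_0)$. This amounts to computing $y_j$ from the normal equations displayed in the claim and setting $z_j=C^Tr_0-D_j^T\underline{H}_jy_j$. *)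

(* Defs.v *)
From mathcomp Require Import all_boot all_order all_algebra.
From mathcomp Require Import reals.

Set Implicit Arguments.
Unset Strict Implicit.
Unset Printing Implicit Defensive.

Import Order.TTheory GRing.Theory Num.Theory.
Local Open Scope ring_scope.

(* Not the norm [`| x |] that MathComp-Analysis puts on matrices, which is the
   sup norm. *)
Definition enorm (R : realType) (n : nat) (x : 'cV[R]_n) : R :=
  Num.sqrt (\sum_i x i 0 ^+ 2).

Definition dot (R : realType) (n : nat) (x y : 'cV[R]_n) : R :=
  (x^T *m y) 0 0.

(* { X }_{1:j} for a matrix X with j + 1 rows. *)
Definition top_rows (R : realType) (j k : nat) (X : 'M[R]_(j.+1, k)) :
  'M[R]_(j, k) := rowsub (widen_ord (leqnSn j)) X.

Definition upper_triangular (R : realType) (m p : nat) (X : 'M[R]_(m, p)) :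
  Prop := forall (i : 'I_m) (l : 'I_p), (l < i)%N -> X i l = 0.

Section Arnoldi.
Variables (R : realType) (n : nat).
Implicit Types (v : nat -> 'cV[R]_n) (h : nat -> nat -> R).

(* Indices start from 0: [v l] is the (l+1)-st Arnoldi vector. *)
Definition arnoldi_V v (m : nat) : 'M[R]_(n, m) :=
  \matrix_(i < n, l < m) v l i 0.

Definition arnoldi_H h (j : nat) : 'M[R]_(j.+1, j) :=
  \matrix_(i < j.+1, l < j) h i l.

Definition arnoldi_w (A : 'M[R]_n) v h (l : nat) : 'cV[R]_n :=
  A *m v l - \sum_(i < l.+1) h i l *: v i.

(* [v] and [h] are the output of j iterations of the Arnoldi process started
   from w0.  The (l+1)-st iteration produces the vector [v l.+1] only if it
   does not break down, i.e. only if [h l.+1 l != 0]. The values of [v] beyond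
   index j and of [h] beyond column j are irrelevant. *)
Record arnoldi (A : 'M[R]_n) (w0 : 'cV[R]_n) (j : nat) v h : Prop := Arnoldi {
  arnoldi_start_neq0 : w0 != 0;
  arnoldi_start : v 0%N = (enorm w0)^-1 *: w0;
  arnoldi_coef : forall l i, (l < j)%N -> (i <= l)%N ->
    h i l = dot (v i) (A *m v l);
  arnoldi_subdiag : forall l, (l < j)%N ->
    h l.+1 l = enorm (arnoldi_w A v h l);
  arnoldi_no_breakdown : forall l, (l < j)%N -> h l.+1 l != 0;
  arnoldi_next : forall l, (l < j)%N ->
    v l.+1 = (h l.+1 l)^-1 *: arnoldi_w A v h l;
  arnoldi_hessenberg : forall l i, (l < j)%N -> (l.+1 < i)%N -> h i l = 0
}.

End Arnoldi.

Section Givens.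
Variable R : realType.

(* Rotation [c s; -s c] in the coordinate plane (l, l+1) of R^{j+1}. *)
Definition givens (j l : nat) (c s : R) : 'M[R]_j.+1 :=
  \matrix_(i, k)
    if (i == l :> nat) && (k == l :> nat) then c
    else if (i == l :> nat) && (k == l.+1 :> nat) then s
    else if (i == l.+1 :> nat) && (k == l :> nat) then - s
    else if (i == l.+1 :> nat) && (k == l.+1 :> nat) then c
    else (i == k)%:R.

(* Q_j^T = G_{j-1} ... G_1 G_0.  The same rotation parameters are used for
   every j: passing from Q_j to Q_{j+1} appends one rotation. *)
Definition givens_Q (c s : nat -> R) (j : nat) : 'M[R]_j.+1 :=
  \prod_(l < j) (givens j l (c l) (s l))^T.

(* [Rb l] is the (l+1) x l triangular factor of the l-th Hessenberg matrix. *)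
Record givens_QR (h : nat -> nat -> R) (j : nat) (c s : nat -> R)
    (Rb : forall l, 'M[R]_(l.+1, l)) : Prop := GivensQR {
  givens_rotation : forall l, (l < j)%N -> c l ^+ 2 + s l ^+ 2 = 1;
  givens_factor : forall l, (l <= j)%N ->
    arnoldi_H h l = givens_Q c s l *m Rb l;
  givens_triangular : forall l, (l <= j)%N -> upper_triangular (Rb l)
}.

End Givens.

(* Main.v *)
(* Since the Arnoldi vectors are orthonormal and C^T C = I, the normal equations
   are those of minimizing ||(I - Phi)(r0 - A V_j y)||.  The last row of the
   triangular factor vanishes, so R_j^T factors out of both sides of the normal
   equations; it cancels because R_j is invertible, the subdiagonal of the
   Hessenberg matrix having no zero.  For the bound, compare the minimizer with
   the coefficients of plain GMRES, R_j z = { Q_j^T V_{j+1}^T r0 }_{1:j}, and use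
   that I - Phi does not increase norms. *)

Require Import Defs.
From mathcomp Require Import all_boot all_order all_algebra.
From mathcomp Require Import reals.
From mathcomp Require Import ring.

Set Implicit Arguments.
Unset Strict Implicit.
Unset Printing Implicit Defensive.

Import Order.TTheory GRing.Theory Num.Theory.
Local Open Scope ring_scope.

(** * Inner products, orthogonal projectors and projected least squares *)

Section Euclidean.
Variable R : realType.

Lemma dotE n (x y : 'cV[R]_n) : dot x y = \sum_i x i 0 * y i 0.
Proof. by rewrite /dot mxE; apply: eq_bigr => i _; rewrite mxE. Qed.

Lemma dotC n (x y : 'cV[R]_n) : dot x y = dot y x.
Proof. by rewrite !dotE; apply: eq_bigr => i _; rewrite mulrC. Qed.

Lemma dotDr n (x y z : 'cV[R]_n) : dot x (y + z) = dot x y + dot x z.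
Proof. by rewrite /dot mulmxDr mxE. Qed.

Lemma dotDl n (x y z : 'cV[R]_n) : dot (x + y) z = dot x z + dot y z.
Proof. by rewrite dotC dotDr !(dotC z). Qed.

Lemma dotBr n (x y z : 'cV[R]_n) : dot x (y - z) = dot x y - dot x z.
Proof. by rewrite /dot mulmxBr !mxE. Qed.

Lemma dotZr n a (x y : 'cV[R]_n) : dot x (a *: y) = a * dot x y.
Proof. by rewrite /dot -scalemxAr mxE. Qed.

Lemma dotZl n a (x y : 'cV[R]_n) : dot (a *: x) y = a * dot x y.
Proof. by rewrite dotC dotZr dotC. Qed.

Lemma dot_sumr n m (x : 'cV[R]_n) (F : 'I_m -> 'cV[R]_n) :
  dot x (\sum_i F i) = \sum_i dot x (F i).
Proof. by rewrite /dot mulmx_sumr summxE. Qed.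

Lemma dot_mulmxr m n (x : 'cV[R]_m) (B : 'M[R]_(m, n)) (y : 'cV[R]_n) :
  dot x (B *m y) = dot (B^T *m x) y.
Proof. by rewrite /dot trmx_mul trmxK mulmxA. Qed.

Lemma enorm_sqr n (x : 'cV[R]_n) : enorm x ^+ 2 = dot x x.
Proof.
rewrite dotE /enorm sqr_sqrtr; last by apply: sumr_ge0 => i _; exact: sqr_ge0.
by apply: eq_bigr => i _; rewrite expr2.
Qed.

Lemma enorm_eq0 n (x : 'cV[R]_n) : (enorm x == 0) = (x == 0).
Proof.
rewrite -sqrf_eq0 enorm_sqr dotE psumr_eq0 => [|i _]; last first.
  by rewrite -expr2 sqr_ge0.
apply/allP/eqP => [x0|-> i _]; last by rewrite /= mxE mulr0 eqxx.
apply/matrixP => i l; rewrite ord1 mxE; apply/eqP.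
by have := x0 i (mem_index_enum _); rewrite /= -expr2 sqrf_eq0.
Qed.

Lemma enorm0 n : enorm (0 : 'cV[R]_n) = 0.
Proof. by apply/eqP; rewrite enorm_eq0. Qed.

Lemma dot_normalized n (x : 'cV[R]_n) : x != 0 ->
  dot ((enorm x)^-1 *: x) ((enorm x)^-1 *: x) = 1.
Proof.
rewrite -enorm_eq0 => x0.
by rewrite dotZl dotZr -enorm_sqr expr2 mulKf ?mulVf.
Qed.

Lemma enorm_sqrD n (x y : 'cV[R]_n) : dot x y = 0 ->
  enorm (x + y) ^+ 2 = enorm x ^+ 2 + enorm y ^+ 2.
Proof.
by move=> xy; rewrite !enorm_sqr dotDr !dotDl (dotC y x) xy addr0 add0r.
Qed.

Lemma enorm_mulmx n m (B : 'M[R]_(n, m)) (x : 'cV[R]_m) :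
  B^T *m B = 1%:M -> enorm (B *m x) ^+ 2 = enorm x ^+ 2.
Proof. by move=> BB; rewrite !enorm_sqr dot_mulmxr mulmxA BB mul1mx. Qed.

Lemma mulmx_tr_proj n m (B : 'M[R]_(n, m)) : B^T *m B = 1%:M ->
  B^T *m (1%:M - B *m B^T) = 0.
Proof. by move=> BB; rewrite mulmxBr mulmx1 mulmxA BB mul1mx subrr. Qed.

Lemma trmx_proj n m (B : 'M[R]_(n, m)) :
  (1%:M - B *m B^T)^T = 1%:M - B *m B^T.
Proof. by rewrite linearB /= trmx1 trmx_mul trmxK. Qed.

Lemma mulmx_proj n m (B : 'M[R]_(n, m)) : B^T *m B = 1%:M ->
  (1%:M - B *m B^T) *m (1%:M - B *m B^T) = 1%:M - B *m B^T.
Proof.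
by move=> BB; rewrite {1}mulmxBl mul1mx -mulmxA mulmx_tr_proj// mulmx0 subr0.
Qed.

(** Pythagoras for the splitting of [x] into its components outside and inside the column space of
    [B]; the inner component [B *m B^T *m x] has the norm of [B^T *m x]. *)
Lemma enorm_proj n m (B : 'M[R]_(n, m)) (x : 'cV[R]_n) : B^T *m B = 1%:M ->
  enorm ((1%:M - B *m B^T) *m x) ^+ 2 = enorm x ^+ 2 - enorm (B^T *m x) ^+ 2.
Proof.
move=> BB; rewrite -(enorm_mulmx (B^T *m x) BB).
apply/eqP; rewrite eq_sym subr_eq -enorm_sqrD.
  by rewrite mulmxBl mul1mx -mulmxA subrK.
by rewrite dot_mulmxr mulmxA mulmx_tr_proj// mul0mx /dot trmx0 mul0mx mxE.
Qed.

Lemma enorm_proj_le n m (B : 'M[R]_(n, m)) (x : 'cV[R]_n) : B^T *m B = 1%:M ->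
  enorm ((1%:M - B *m B^T) *m x) ^+ 2 <= enorm x ^+ 2.
Proof. by move=> BB; rewrite enorm_proj// gerBl sqr_ge0. Qed.

(** The normal equations make the projected residual at [y] orthogonal to the range of [P *m W].
    Moving from [y] to [z] adds the vector [P *m W *m (y - z)] of that range, so by Pythagoras the
    norm cannot decrease. *)
Lemma normal_eq_proj_min n m k (C : 'M[R]_(n, k)) (W : 'M[R]_(n, m))
    (r : 'cV[R]_n) (y z : 'cV[R]_m) (P := 1%:M - C *m C^T) :
  C^T *m C = 1%:M -> W^T *m P *m W *m y = W^T *m P *m r ->
  enorm (P *m (r - W *m y)) ^+ 2 <= enorm (P *m (r - W *m z)) ^+ 2.
Proof.
move=> CC ny.
have -> : r - W *m z = (r - W *m y) + W *m (y - z).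
  by rewrite mulmxBr addrA subrK.
rewrite (mulmxDr P (r - W *m y)) enorm_sqrD ?lerDl ?sqr_ge0//.
rewrite !dot_mulmxr trmx_proj (mulmxA P) mulmx_proj// mulmxA.
by rewrite mulmxBr mulmxA ny subrr /dot trmx0 mul0mx mxE.
Qed.

End Euclidean.

(** * Splitting off the last row *)

Section TopRows.
Variable R : realType.

Lemma top_rowsE j k (X : 'M[R]_(j.+1, k)) i l :
  top_rows X i l = X (widen_ord (leqnSn j) i) l.
Proof. by rewrite mxE. Qed.

(** Separates the last summand of each inner product of columns. It vanishes when [X] or [Y] is a
    triangular factor with zero last row. *)
Lemma mulmx_top_rows j k p (X : 'M[R]_(j.+1, k)) (Y : 'M[R]_(j.+1, p)) :
  X^T *m Y = (top_rows X)^T *m top_rows Y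
             + (row ord_max X)^T *m row ord_max Y.
Proof.
apply/matrixP => a b; rewrite !mxE big_ord_recr /= big_ord1 !mxE.
by congr (_ + _); apply: eq_bigr => i _; rewrite !mxE.
Qed.

Lemma top_rows_mul j k p (X : 'M[R]_(j.+1, k)) (Y : 'M[R]_(k, p)) :
  top_rows (X *m Y) = top_rows X *m Y.
Proof. by rewrite /top_rows mul_rowsub_mx. Qed.

Lemma top_rowsB j k (X Y : 'M[R]_(j.+1, k)) :
  top_rows (X - Y) = top_rows X - top_rows Y.
Proof. by apply/matrixP => a b; rewrite !mxE. Qed.

Lemma enorm_top_rows j (x : 'cV[R]_j.+1) :
  enorm x ^+ 2 = enorm (top_rows x) ^+ 2 + x ord_max 0 ^+ 2.
Proof.
rewrite !enorm_sqr /dot mulmx_top_rows mxE.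
by rewrite [X in _ + X]mxE big_ord1 !mxE.
Qed.

(** With one row more than columns, the whole last row lies below the diagonal. *)
Lemma upper_triangular_last_row j (X : 'M[R]_(j.+1, j)) :
  upper_triangular X -> row ord_max X = 0.
Proof. by move=> tX; apply/matrixP => a b; rewrite !mxE tX/=. Qed.

Lemma delta_mx_last j (x : 'cV[R]_j.+1) :
  ((delta_mx ord_max 0 : 'cV[R]_j.+1)^T *m x) 0 0 = x ord_max 0.
Proof. by rewrite trmx_delta -rowE mxE. Qed.

End TopRows.

(** * Orthonormality and the Arnoldi relation *)

Section ArnoldiProcess.
Variables (R : realType) (n : nat) (A : 'M[R]_n) (w0 : 'cV[R]_n) (j : nat).
Variables (v : nat -> 'cV[R]_n) (h : nat -> nat -> R).
Hypothesis arn : arnoldi A w0 j v h.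

(** Induction along the Gram-Schmidt process: each new vector is orthogonal to the earlier ones by
    the choice of the coefficients, and has unit length because the subdiagonal entry is the nonzero
    norm it is divided by. *)
Lemma arnoldi_dot m i l : (m <= j)%N -> (i <= m)%N -> (l <= m)%N ->
  dot (v i) (v l) = (i == l)%:R.
Proof.
elim: m i l => [|m IH] i l mj.
  rewrite !leqn0 => /eqP-> /eqP->; rewrite (arnoldi_start arn).
  by rewrite dot_normalized ?(arnoldi_start_neq0 arn).
have hm := arnoldi_no_breakdown arn mj.
have orth a : (a <= m)%N -> dot (v a) (v m.+1) = 0.
  move=> am; rewrite (arnoldi_next arn mj) dotZr /arnoldi_w dotBr dot_sumr.
  have la : (a < m.+1)%N by [].
  (* By the induction hypothesis only the summand of index [a] survives, and it cancels the inner
     product of [v a] with [A *m v m]. *)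
  rewrite (bigD1 (Ordinal la))//= big1 ?addr0 => [|b ba].
    rewrite dotZr (IH a a)// ?(ltnW mj)// eqxx mulr1.
    by rewrite [h a m](arnoldi_coef arn)// subrr mulr0.
  rewrite dotZr (IH a b)// ?(ltnW mj)//; last by rewrite -ltnS.
  have -> : (a == b :> nat) = false by rewrite eq_sym; exact: negbTE.
  by rewrite mulr0.
rewrite leq_eqVlt => /orP[/eqP->|im]; rewrite leq_eqVlt => /orP[/eqP->|lm].
- rewrite eqxx (arnoldi_next arn mj) (arnoldi_subdiag arn mj).
  by rewrite dot_normalized// -enorm_eq0 -(arnoldi_subdiag arn mj).
- by rewrite dotC orth// gtn_eqF.
- by rewrite orth// ltn_eqF.
- by apply: IH; rewrite // ltnW.
Qed.

Lemma arnoldi_V_orthonormal m : (m <= j)%N ->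
  (arnoldi_V v m.+1)^T *m arnoldi_V v m.+1 = 1%:M.
Proof.
move=> mj; apply/matrixP => a b; rewrite !mxE.
rewrite -(arnoldi_dot mj (leq_ord a) (leq_ord b)) dotE.
by apply: eq_bigr => i _; rewrite !mxE.
Qed.

Lemma arnoldi_relation :
  A *m arnoldi_V v j = arnoldi_V v j.+1 *m arnoldi_H h j.
Proof.
apply/matrixP => i l; have lj := ltn_ord l.
have colE : A *m v l = \sum_(a < j.+1) h a l *: v a.
  have -> : A *m v l = \sum_(a < l.+2) h a l *: v a.
    rewrite big_ord_recr /= (arnoldi_next arn lj) scalerA divff.
      by rewrite scale1r /arnoldi_w addrC subrK.
    exact: (arnoldi_no_breakdown arn).
  (* The Hessenberg zeros extend the recurrence from [l.+2] to [j.+1] terms. *)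
  rewrite (big_ord_widen j.+1 (fun a => h a l *: v a))// big_mkcond /=.
  apply: eq_bigr => a _; case: ltnP => // la.
  by rewrite (arnoldi_hessenberg arn)// scale0r.
transitivity ((A *m v l) i 0).
  by rewrite !mxE; apply: eq_bigr => a _; rewrite mxE.
rewrite colE summxE mxE; apply: eq_bigr => a _.
by rewrite !mxE mulrC.
Qed.

(* Deleting the first row of H leaves a square triangular matrix with the
   subdiagonal of H as its diagonal. *)
Lemma arnoldi_H_lower_unit : rowsub (lift ord0) (arnoldi_H h j) \in unitmx.
Proof.
rewrite -unitmx_tr unitmxE det_trig; last first.
  apply/is_trig_mxP => a b ab; rewrite !mxE /=.
  by apply: (arnoldi_hessenberg arn).
rewrite unitfE; apply/prodf_neq0 => a _; rewrite !mxE /=.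
exact: (arnoldi_no_breakdown arn).
Qed.

End ArnoldiProcess.

(** * Products of Givens rotations *)

Section GivensRotations.
Variable R : realType.

(** The index [q] is a separate ordinal tied to [p] by its value, since the successor of [p] may be
    out of range. *)
Lemma mulmx_givens j k (c s : R) (p q : 'I_j.+1) (u : 'M[R]_(j.+1, k)) i a :
  q = p.+1 :> nat ->
  (givens j p c s *m u) i a =
    if i == p then c * u p a + s * u q a
    else if i == q then - s * u p a + c * u q a
    else u i a.
Proof.
move=> qp; have qNp : (q == p) = false by rewrite -val_eqE /= qp gtn_eqF.
have pNq : (p == q) = false by rewrite eq_sym.
rewrite mxE (bigD1 p)//= (bigD1 q) ?qNp//= !mxE -!qp !val_eqE !eqxx pNq qNp /=.
(* Apart from the columns [p] and [q], row [b] of the rotation is zero if [b] is [p] or [q];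
   otherwise only its diagonal entry remains. *)
have rest (b : 'I_j.+1) (B : pred 'I_j.+1) :
    (forall l, B l -> givens j p c s b l = 0) ->
    \sum_(l | B l) givens j p c s b l * u l a = 0.
  by move=> B0; apply: big1 => l Bl; rewrite B0 ?mul0r.
have [->|iNp] := eqVneq i p.
  rewrite /= rest ?addr0// => l /andP[/negbTE lp /negbTE lq].
  by rewrite mxE -!qp !val_eqE eqxx lp lq pNq eq_sym lp.
have [->|iNq] := eqVneq i q.
  rewrite /= rest ?addr0// => l /andP[/negbTE lp /negbTE lq].
  by rewrite mxE -!qp !val_eqE eqxx lp lq qNp eq_sym lq.
rewrite /= !mul0r !add0r (bigD1 i) ?iNp//= mxE -!qp !val_eqE.
rewrite (negbTE iNp) (negbTE iNq) eqxx mul1r rest ?addr0// => l /andP[_ li].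
by rewrite mxE -!qp !val_eqE (negbTE iNp) (negbTE iNq) (eq_sym i) (negbTE li).
Qed.

Lemma trmx_givens j l (c s : R) : (givens j l c s)^T = givens j l c (- s).
Proof.
apply/matrixP => a b; rewrite !mxE opprK (eq_sym b a).
have [al|] := eqVneq (a : nat) l; have [bl|] := eqVneq (b : nat) l => //= _.
- by rewrite al (ltn_eqF (ltnSn l)) andbT andbF.
- by rewrite andbT andbF andbC.
- by rewrite !andbF andbC.
Qed.

Lemma givens_orthogonal j l (c s : R) : (l < j)%N -> c ^+ 2 + s ^+ 2 = 1 ->
  givens j l c s *m (givens j l c s)^T = 1%:M.
Proof.
move=> lj cs; rewrite trmx_givens.
pose p : 'I_j.+1 := Ordinal (ltnW lj : (l < j.+1)%N).
pose q : 'I_j.+1 := Ordinal (lj : (l.+1 < j.+1)%N).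
have qNp : (q == p) = false by rewrite -val_eqE /= gtn_eqF.
(* The identity factor allows both rotations to be evaluated as row operations on it. *)
rewrite -[givens j l c (- s)]mulmx1; apply/matrixP => a b.
rewrite !(@mulmx_givens _ _ _ _ p q)// !eqxx qNp opprK /=.
have {}cs : c ^+ 2 = 1 - s ^+ 2 by rewrite -cs addrK.
case: (eqVneq a p) => [->|_].
  by move: (1%:M p b) (1%:M q b) => x y; ring: cs.
case: (eqVneq a q) => [->|//].
by move: (1%:M p b) (1%:M q b) => x y; ring: cs.
Qed.

(** Decouples the number [m] of rotations from the size [j.+1], which [givens_Q] ties together. This
    permits induction on [m] and comparison of products of different sizes. *)
Definition givens_prod (c s : nat -> R) (j m : nat) : 'M[R]_j.+1 :=
  \prod_(l < m) (givens j l (c l) (s l))^T.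

Lemma givens_prodS c s j m :
  givens_prod c s j m.+1 =
    givens_prod c s j m *m (givens j m (c m) (s m))^T.
Proof. by rewrite /givens_prod big_ord_recr. Qed.

Lemma givens_prod_orthogonal (c s : nat -> R) j m : (m <= j)%N ->
  (forall l, (l < m)%N -> c l ^+ 2 + s l ^+ 2 = 1) ->
  (givens_prod c s j m)^T *m givens_prod c s j m = 1%:M.
Proof.
elim: m => [|m IH] mj cs; first by rewrite /givens_prod big_ord0 trmx1 mulmx1.
rewrite givens_prodS trmx_mul trmxK -mulmxA (mulmxA _^T) IH ?(ltnW mj)//.
  by rewrite mul1mx givens_orthogonal// cs.
by move=> l lm; apply: cs; rewrite ltnW.
Qed.

(* The first m rotations act on the first m + 1 coordinates only. *)
Lemma givens_prod_top (c s : nat -> R) j k m (u : 'M[R]_(j.+2, k)) :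
  (m <= j)%N ->
  top_rows ((givens_prod c s j.+1 m)^T *m u)
    = (givens_prod c s j m)^T *m top_rows u
  /\ row ord_max ((givens_prod c s j.+1 m)^T *m u) = row ord_max u.
Proof.
elim: m => [|m IH] mj.
  by rewrite /givens_prod !big_ord0 !trmx1 !mul1mx.
have [IHt IHl] := IH (ltnW mj).
rewrite !givens_prodS !trmx_mul !trmxK -!mulmxA -IHt -IHl.
move: (_ *m u) => x.
pose p : 'I_j.+1 := Ordinal (ltnW mj : (m < j.+1)%N).
pose q : 'I_j.+1 := Ordinal (mj : (m.+1 < j.+1)%N).
pose p' := widen_ord (leqnSn j.+1) p; pose q' := widen_ord (leqnSn j.+1) q.
split; apply/matrixP => i a.
  rewrite top_rowsE (@mulmx_givens _ _ _ _ p' q')//.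
  by rewrite (@mulmx_givens _ _ _ _ p q)// !top_rowsE.
rewrite mxE (@mulmx_givens _ _ _ _ p' q')// -!val_eqE /=.
by rewrite mxE !gtn_eqF // ltnW.
Qed.

(** The first [l] rotations leave the last coordinate alone and act on the others as the smaller
    [givens_Q]; the one new rotation then mixes the last two coordinates. *)
Lemma givens_Q_last (c s : nat -> R) l (u : 'cV[R]_l.+2) :
  ((givens_Q c s l.+1)^T *m u) ord_max 0
    = - s l * ((givens_Q c s l)^T *m top_rows u) ord_max 0
      + c l * u ord_max 0.
Proof.
have [top last] := givens_prod_top c s u (leqnn l).
rewrite [givens_Q c s l.+1]givens_prodS trmx_mul trmxK -mulmxA.
pose p : 'I_l.+2 := widen_ord (leqnSn l.+1) ord_max.
rewrite (@mulmx_givens _ _ _ _ p ord_max)// eqxx -val_eqE /= gtn_eqF//.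
rewrite -top_rowsE top.
by move/matrixP: last => /(_ 0 0); rewrite !mxE => ->.
Qed.

End GivensRotations.

(** * Equivalence of the two systems, the residual bound and its progressive update *)

Theorem theorem4p2 (R : realType) (n k j : nat)
  (A : 'M[R]_n) (b x0 w0 : 'cV[R]_n) (U : 'M[R]_(n, k))
  (v : nat -> 'cV[R]_n) (h : nat -> nat -> R)
  (c s : nat -> R) (Rb : forall l : nat, 'M[R]_(l.+1, l)) :
  let r0 := b - A *m x0 in
  let C := A *m U in
  let Phi := C *m C^T in
  let V := arnoldi_V v in
  let H := arnoldi_H h j in
  let D := (V j.+1)^T *m C in
  let Q := givens_Q c s in
  let Rj := top_rows (Rb j) in
  let M := top_rows ((Q j)^T *m D) in
  let normal_eq (y : 'cV[R]_j) :=
    (H^T *m H - H^T *m D *m D^T *m H) *m y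
    = H^T *m ((V j.+1)^T *m ((1%:M - Phi) *m r0)) in
  let linear_system (y : 'cV[R]_j) :=
    (1%:M - M *m M^T) *m Rj *m y
    = top_rows ((Q j)^T *m ((V j.+1)^T *m ((1%:M - Phi) *m r0))) in
  let tau (l : nat) : R :=
    ((delta_mx ord_max 0 : 'cV[R]_l.+1)^T
       *m ((Q l)^T *m ((V l.+1)^T *m r0))) 0 0 in
  let rho (l : nat) : R :=
    enorm ((1%:M - V l.+1 *m (V l.+1)^T) *m r0) in
  (w0 = r0 \/ w0 = A *m r0) ->
  arnoldi A w0 j v h ->
  C^T *m C = 1%:M ->
  givens_QR h j c s Rb ->
  [/\ forall y : 'cV[R]_j, normal_eq y <-> linear_system y,
      forall y : 'cV[R]_j, normal_eq y ->
        enorm ((1%:M - C *m C^T) *m (b - A *m (x0 + V j *m y))) ^+ 2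
        <= `|tau j| ^+ 2 + rho j ^+ 2
    & forall l : nat, (l < j)%N ->
        tau l.+1 = - s l * tau l + c l * dot (v l.+1) r0 /\
        rho l.+1 ^+ 2 = rho l ^+ 2 - dot (v l.+1) r0 ^+ 2].
Proof.
move=> r0 C Phi V H D Q Rj M normal_eq linear_system tau rho _ arn CC gqr.
have VV l : (l <= j)%N -> (V l.+1)^T *m V l.+1 = 1%:M.
  exact: (arnoldi_V_orthonormal arn).
have AV : A *m V j = V j.+1 *m H := arnoldi_relation arn.
have QQ : (Q j)^T *m Q j = 1%:M.
  by apply: givens_prod_orthogonal => // l; exact: (givens_rotation gqr).
have HE : H = Q j *m Rb j := givens_factor gqr (leqnn j).
have last0 : row ord_max (Rb j) = 0.
  exact: upper_triangular_last_row (givens_triangular gqr (leqnn j)).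
(* Since the last row of [Rb j] is zero, [H^T] sees only the top rows of [(Q j)^T *m X]; this is
   what brings out the factor [Rj^T]. *)
have HtE p (X : 'M[R]_(j.+1, p)) : H^T *m X = Rj^T *m top_rows ((Q j)^T *m X).
  rewrite HE trmx_mul -mulmxA (mulmx_top_rows (Rb j)) last0.
  by rewrite trmx0 mul0mx addr0.
have QtH : top_rows ((Q j)^T *m H) = Rj by rewrite HE mulmxA QQ mul1mx.
(* The invertible lower block of [H] is the corresponding rows of [Q j] times [Rb j]. The zero last
   row of [Rb j] reduces this to a product of two square matrices, the second being [Rj], so [Rj] is
   invertible. *)
have Rj_unit : Rj \in unitmx.
  have := arnoldi_H_lower_unit arn; rewrite -/H HE -mul_rowsub_mx.
  rewrite -[rowsub _ _]trmxK (mulmx_top_rows _ (Rb j)) last0 mulmx0 addr0.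
  by rewrite unitmx_mul => /andP[].
have gramE : H^T *m H - H^T *m D *m D^T *m H
             = Rj^T *m ((1%:M - M *m M^T) *m Rj).
  have HtD : H^T *m D = Rj^T *m M by exact: HtE.
  have DtH : D^T *m H = M^T *m Rj.
    by rewrite -[LHS]trmxK trmx_mul trmxK HtD trmx_mul trmxK.
  rewrite -mulmxA HtD DtH HtE QtH mulmxBl mul1mx mulmxBr.
  by rewrite !mulmxA.
have linE y : normal_eq y <-> linear_system y.
  rewrite /normal_eq /linear_system gramE HtE -mulmxA.
  by split=> [/(can_inj (mulKmx _))->|->]; rewrite ?unitmx_tr.
split=> // [y ny|l lj].
- have -> z : b - A *m (x0 + V j *m z) = r0 - V j.+1 *m H *m z.
    by rewrite mulmxDr mulmxA AV opprD addrA.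
  (* Puts the normal equations in the form of [normal_eq_proj_min] with [W] equal to
     [V j.+1 *m H]. *)
  have gramWE : (V j.+1 *m H)^T *m (1%:M - C *m C^T) *m (V j.+1 *m H)
                = H^T *m H - H^T *m D *m D^T *m H.
    rewrite trmx_mul mulmxBr mulmx1 mulmxBl; congr (_ - _).
      by rewrite -mulmxA (mulmxA (V j.+1)^T) VV// mul1mx.
    by rewrite /D (trmx_mul (V j.+1)^T C) trmxK !mulmxA.
  have {}ny : (V j.+1 *m H)^T *m (1%:M - C *m C^T) *m (V j.+1 *m H) *m y
              = (V j.+1 *m H)^T *m (1%:M - C *m C^T) *m r0.
    by rewrite gramWE ny trmx_mul !mulmxA.
  (* [z] is the plain GMRES solution: it cancels all coordinates of the rotated residual
     [u - Rb j *m z] but the last, which no choice of [z] can change. *)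
  pose u := (Q j)^T *m ((V j.+1)^T *m r0).
  pose z := invmx Rj *m top_rows u.
  apply: le_trans (normal_eq_proj_min z CC ny) _.
  apply: le_trans (enorm_proj_le _ CC) _.
  have QzE : (Q j)^T *m (V j.+1)^T *m (r0 - V j.+1 *m H *m z) = u - Rb j *m z.
    rewrite mulmxBr -!mulmxA (mulmxA (V j.+1)^T) VV// mul1mx HE.
    by rewrite -(mulmxA (Q j)) (mulmxA (Q j)^T (Q j)) QQ mul1mx.
  have topQz : top_rows (u - Rb j *m z) = 0.
    by rewrite top_rowsB top_rows_mul mulKVmx// subrr.
  have lastQz : (u - Rb j *m z) ord_max 0 = tau j.
    have rowE : (Rb j *m z) ord_max 0 = row ord_max (Rb j *m z) 0 0.
      by rewrite [RHS]mxE.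
    rewrite /tau delta_mx_last mxE [X in _ + X]mxE rowE.
    by rewrite row_mul last0 mul0mx [X in _ - X]mxE subr0.
  (* Pythagoras with respect to the range of [V j.+1]. The outer component is that of [r0], which
     gives [rho j]; the inner one keeps its norm under [(Q j)^T] and reduces to [tau j]. *)
  rewrite -[leLHS](subrK (enorm ((V j.+1)^T *m (r0 - V j.+1 *m H *m z)) ^+ 2)).
  rewrite -enorm_proj ?VV// mulmxBr -(mulmxA (V j.+1)) (mulmxA _ (V j.+1)).
  rewrite (mulmxBl _ _ (V j.+1)) mul1mx -(mulmxA (V j.+1)) VV// mulmx1 subrr.
  rewrite mul0mx subr0 -/(rho j) addrC lerD2r -(enorm_mulmx (B := (Q j)^T)).
    rewrite mulmxA (mulmxA (V j.+1)) QzE enorm_top_rows topQz lastQz enorm0.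
    by rewrite expr0n add0r real_normK ?num_real.
  by rewrite trmxK; exact: mulmx1C.
(* A further iteration appends the single entry [dot (v l.+1) r0] to [(V l.+1)^T *m r0]; both
   updates follow from this. *)
- have topV : top_rows ((V l.+2)^T *m r0) = (V l.+1)^T *m r0.
    by rewrite top_rows_mul; congr (_ *m _); apply/matrixP => a i; rewrite !mxE.
  have lastV : ((V l.+2)^T *m r0) ord_max 0 = dot (v l.+1) r0.
    by rewrite mxE dotE; apply: eq_bigr => i _; rewrite !mxE.
  split; first by rewrite /tau !delta_mx_last givens_Q_last topV lastV.
  rewrite /rho !enorm_proj ?VV// ?(ltnW lj)//.
  by rewrite (enorm_top_rows ((V l.+2)^T *m r0)) topV lastV opprD addrA.
Qed.
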